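(* Let $m=k$ and let $\Omega_{\mathrm s}=\{Q\in\mathbb{S}_+^k:\operatorname{Tr}(Q)=1\}$. Consider the closed-loop system, for $t\in\mathbb{Z}_+$, $$X_{t+1}=\mathcal{A}(X_t)+\mathcal{B}\bigl(\Theta\Psi(X_t,t)+U_t\bigr),\qquad U_t=-\mathcal{K}(X_t)-\widehat{\Theta}_t\Psi(X_t,t)+U_t^{\mathrm d},$$ with arbitrary initial state $X_0\in\mathbb{R}^{n_1\times n_2}$, where $\widehat\Theta_0=I/k$ and $$\widehat{\Theta}_{t+1}=\frac{\exp\bigl(\ln(\widehat{\Theta}_t)-\eta_{t+1}\operatorname{Sym}(\nabla J_t(\widehat{\Theta}_t))\bigr)}{\operatorname{Tr}\Bigl(\exp\bigl(\ln(\widehat{\Theta}_t)-\eta_{t+1}\operatorname{Sym}(\nabla J_t(\widehat{\Theta}_t))\bigr)\Bigr)},\qquad \eta_{t+1}=\frac{2J_t(\widehat{\Theta}_t)}{\epsilon_{t+1}+\|\operatorname{Sym}(\nabla J_t(\widehat{\Theta}_t))\|_{\mathrm{S}_\infty}^2},$$ for a nonnegative bounded sequence $\{\epsilon_{t+1}\}_{t\in\mathbb{Z}_+}$. Suppose that $\Theta\in\Omega_{\mathrm s}$. Then for every integer $T\ge1$ the regret $\operatorname{Reg}(T):=\sum_{t=0}^{T-1}J_t(\widehat\Theta_t)$ satisfies $$\operatorname{Reg}(T)\le\sqrt{\frac{\ln(k)}2\sum_{t=0}^{T-1}\left(\epsilon_{t+1}+\|\operatorname{Sym}(\nabla J_t(\widehat\Theta_t))\|_{\mathrm{S}_\infty}^2\right)}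 .$$
   Context: Fix positive integers $n_1,n_2,k$ and $m=k$. Matrix spaces carry the Frobenius inner product $\langle X,Y\rangle=\operatorname{Tr}(X^\top Y)$ and Frobenius norm $\|\cdot\|_{\mathrm F}$. $\mathcal{A}:\mathbb{R}^{n_1\times n_2}\to\mathbb{R}^{n_1\times n_2}$, $\mathcal{B}:\mathbb{R}^{m\times n_2}\to\mathbb{R}^{n_1\times n_2}$ and $\mathcal{K}:\mathbb{R}^{n_1\times n_2}\to\mathbb{R}^{m\times n_2}$ are linear operators such that $\mathcal{A}-\mathcal{B}\mathcal{K}$ (i.e. $X\mapsto\mathcal{A}(X)-\mathcal{B}(\mathcal{K}(X))$) is Schur stable (spectral radius $<1$). $\mathcal{B}^\top$ is the adjoint of $\mathcal{B}$: $\langle\mathcal{B}(U),V\rangle=\langle U,\mathcal{B}^\top(V)\rangle$. $\Psi:\mathbb{R}^{n_1\times n_2}\times\mathbb{Z}_+\to\mathbb{R}^{k\times n_2}$ is a map (the regressor), $\{U_t^{\mathrm d}\}_{t\in\mathbb{Z}_+}\subset\mathbb{R}^{m\times n_2}$ is a bounded sequence, and $\Theta$ is the fixed true parameter. Residual, loss and gradient: $$\widetilde X_{t+1}:=X_{t+1}-(\mathcal{A}-\mathcal{B}\mathcal{K})(X_t)-\mathcal{B}(U_t^{\mathrm d})=\mathcal{B}\bigl((\Theta-\widehat\Theta_t)\Psi(X_t,t)\bigr),$$ $$J_t(\widehat\Theta_t):=\tfrac12\bigl\|\mathcal{B}\bigl((\Theta-\widehat\Theta_t)\Psi(X_t,t)\bigr)\bigr\|_{\mathrm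 F}^2=\tfrac12\|\widetilde X_{t+1}\|_{\mathrm F}^2,\qquad \nabla J_t(\widehat\Theta_t)=-\mathcal{B}^\top(\widetilde X_{t+1})\Psi(X_t,t)^\top .$$ $\mathbb{S}_+^k$ is the cone of $k\times k$ real symmetric positive semidefinite matrices; $\operatorname{Sym}(G)=\frac12(G+G^\top)$; $\|\cdot\|_{\mathrm{S}_\infty}$ is the spectral (operator) norm; $\exp$ and $\ln$ are the matrix exponential and the matrix logarithm of positive definite matrices; $I$ is the identity. Convention: if the denominator in the step size is zero (in which case $J_t(\widehat\Theta_t)=0$ too), set $\eta_{t+1}=0$. *)

(* Defs.v *)
From HB Require Import structures.
From mathcomp Require Import all_boot all_order all_algebra.
From mathcomp Require Import all_classical all_reals all_analysis.
From mathcomp Require Import complex ring.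

Set Implicit Arguments.
Unset Strict Implicit.
Unset Printing Implicit Defensive.

Import Order.TTheory GRing.Theory Num.Theory.
Import numFieldNormedType.Exports.

Local Open Scope classical_set_scope.
Local Open Scope ring_scope.

Definition frob_inner (R : realType) (p q : nat) (X Y : 'M[R]_(p, q)) : R :=
  \tr (X^T *m Y).

(* The library's norm on matrices is the entrywise sup norm, hence this one. *)
Definition frob_norm (R : realType) (p q : nat) (X : 'M[R]_(p, q)) : R :=
  Num.sqrt (frob_inner X X).

(* On a column vector the Frobenius norm is the Euclidean norm. *)
Definition spectral_norm (R : realType) (k : nat) (G : 'M[R]_k) : R :=
  sup [set frob_norm (G *m x) | x in [set x : 'cV[R]_k | frob_norm x <= 1]].

Definition sym_part (R : realType) (k : nat) (G : 'M[R]_k) : 'M[R]_k :=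
  2^-1 *: (G + G^T).

Definition psdmx (R : realType) (k : nat) : set 'M[R]_k :=
  [set Q | Q \is symmetricmx /\
           forall x : 'cV[R]_k, 0 <= (x^T *m Q *m x) 0 0].

Definition spectraplex (R : realType) (k : nat) : set 'M[R]_k :=
  [set Q | psdmx Q /\ \tr Q = 1].

(* The limit is taken for the normed topology of 'M[R]_k. *)
Definition expmx (R : realType) (k : nat) (A : 'M[R]_k) : 'M[R]_k :=
  lim (series (fun n => (n`!%:R)^-1 *: A ^+ n) @ \oo).

(* For a positive definite Q, exactly one real symmetric L satisfies          *)
(* expmx L = Q, and L is the logarithm of Q. The value 0 is returned when     *)
(* there is no such L, i.e., when Q is not positive definite.                 *)
Definition lnmx (R : realType) (k : nat) (Q : 'M[R]_k) : 'M[R]_k :=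
  xget 0 [set L | L \is symmetricmx /\ expmx L = Q].

(* The largest modulus of a complex eigenvalue of F, read off the matrix      *)
(* lin_mx F of F in the basis of elementary matrices.                         *)
Definition spectral_radius (R : realType) (p q : nat)
    (F : 'M[R]_(p, q) -> 'M[R]_(p, q)) : R :=
  sup [set complex.Re `|z| | z in
    [set z : R[i] | eigenvalue (map_mx (real_complex R) (lin_mx F)) z]].

Definition schur_stable (R : realType) (p q : nat)
    (F : 'M[R]_(p, q) -> 'M[R]_(p, q)) : Prop :=
  spectral_radius F < 1.

Definition is_adjoint (R : realType) (p q r s : nat)
    (F : 'M[R]_(p, q) -> 'M[R]_(r, s)) (Ft : 'M[R]_(r, s) -> 'M[R]_(p, q)) :=
  forall U V, frob_inner (F U) V = frob_inner U (Ft V).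

(* In loss and loss_grad, psi stands for the regressor value Psi (X t) t.     *)
Definition loss (R : realType) (n1 n2 k : nat)
    (B : 'M[R]_(k, n2) -> 'M[R]_(n1, n2)) (Theta : 'M[R]_k)
    (psi : 'M[R]_(k, n2)) (Th : 'M[R]_k) : R :=
  2^-1 * frob_norm (B ((Theta - Th) *m psi)) ^+ 2.

(* Xres is the residual; loss_gradP below shows that this is the gradient of  *)
(* loss at Th for the Frobenius inner product.                                *)
Definition loss_grad (R : realType) (n1 n2 k : nat)
    (Bt : 'M[R]_(n1, n2) -> 'M[R]_(k, n2)) (psi : 'M[R]_(k, n2))
    (Xres : 'M[R]_(n1, n2)) : 'M[R]_k :=
  - (Bt Xres *m psi^T).

Lemma frob_innerC (R : realType) p q (X Y : 'M[R]_(p, q)) :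
  frob_inner X Y = frob_inner Y X.
Proof. by rewrite /frob_inner -mxtrace_tr trmx_mul trmxK. Qed.

Lemma frob_innerBr (R : realType) p q (X Y Z : 'M[R]_(p, q)) :
  frob_inner X (Y - Z) = frob_inner X Y - frob_inner X Z.
Proof. by rewrite /frob_inner mulmxBr linearB. Qed.

Lemma frob_innerZr (R : realType) p q (a : R) (X Y : 'M[R]_(p, q)) :
  frob_inner X (a *: Y) = a * frob_inner X Y.
Proof. by rewrite /frob_inner -scalemxAr linearZ. Qed.

Lemma sqr_frob_norm (R : realType) p q (X : 'M[R]_(p, q)) :
  frob_norm X ^+ 2 = frob_inner X X.
Proof.
rewrite sqr_sqrtr // /frob_inner /mxtrace sumr_ge0 // => i _.
by rewrite mxE sumr_ge0 // => j _; rewrite mxE -expr2 sqr_ge0.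
Qed.

Lemma loss_gradP (R : realType) (n1 n2 k : nat)
    (B : {linear 'M[R]_(k, n2) -> 'M[R]_(n1, n2)})
    (Bt : 'M[R]_(n1, n2) -> 'M[R]_(k, n2)) (hBt : is_adjoint B Bt)
    (Theta Th V : 'M[R]_k) (psi : 'M[R]_(k, n2)) :
  is_derive Th V (loss B Theta psi)
    (frob_inner (loss_grad Bt psi (B ((Theta - Th) *m psi))) V).
Proof.
set E := B _; set g := frob_inner _ V.
have gE : g = - frob_inner (B (V *m psi)) E.
  rewrite hBt frob_innerC /g frob_innerC /loss_grad /frob_inner.
  rewrite mulmxN raddfN /= mxtrace_mulC -mxtrace_tr !trmx_mul !trmxK.
  by rewrite mulmxA mxtrace_mulC mulmxA [X in - X]mxtrace_mulC mulmxA.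
set c := 2^-1 * frob_inner (B (V *m psi)) (B (V *m psi)).
have lossE h : loss B Theta psi (h *: V + Th)
    = loss B Theta psi Th + h * (g + h * c).
  rewrite /loss !sqr_frob_norm.
  have -> : (Theta - (h *: V + Th)) *m psi
      = (Theta - Th) *m psi - h *: (V *m psi).
    by rewrite opprD addrCA addrC mulmxBl -scalemxAl.
  rewrite linearB linearZ /= -/E gE /c frob_innerBr frob_innerZr.
  rewrite ![frob_inner (_ - _) _]frob_innerC !frob_innerBr !frob_innerZr.
  rewrite (frob_innerC E).
  by field.
suff q_cvg : (fun h : R => h^-1 *: ((loss B Theta psi \o shift Th) (h *: V)
    - loss B Theta psi Th)) @ 0^' --> g.
  by apply: DeriveDef; [apply/cvg_ex; exists g | exact: cvg_lim].
have : (fun h : R => g + h * c) @ 0^' --> g.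
  rewrite -[X in _ --> X]addr0 -[X in _ --> _ + X](mul0r c).
  apply: cvgD; first exact: cvg_cst.
  by apply: cvgM; [exact: nbhs_dnbhs | exact: cvg_cst].
apply: cvg_trans; apply: near_eq_cvg; near=> h.
have h0 : h != 0 by near: h; exact: nbhs_dnbhs_neq.
rewrite /= lossE [X in X - _]addrC addrK.
by rewrite /GRing.scale /= mulKf.
Unshelve. all: by end_near.
Qed.

(* Main.v *)
Require Import Defs.
From HB Require Import structures.
From mathcomp Require Import all_boot all_order all_algebra.
From mathcomp Require Import all_classical all_reals all_analysis.
From mathcomp Require Import complex spectral ring lra.

Import Order.TTheory GRing.Theory Num.Theory.
Import numFieldNormedType.Exports.
Local Open Scope ring_scope.

Set Implicit Arguments.
Unset Strict Implicit.
Unset Printing Implicit Defensive.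

(** The iteration is mirror descent for the von Neumann entropy, and the
    potential is the cross entropy Phi_t = - Tr (Theta L_t), where
    L_t = ln That_t. It starts at ln k because That_0 = I / k and
    Tr Theta = 1, and it stays nonnegative because That_t has eigenvalues at
    most 1, so that L_t is negative semidefinite. With S_t the symmetric part
    of the gradient and s_t its spectral norm, one step satisfies
<<
    Phi_{t+1} <= Phi_t - eta Tr ((That_t - Theta) S_t) + (eta s_t)^2 / 2
>>
    ([exp_gradient_step]). The loss is quadratic with minimal value 0 at Theta,
    hence the middle trace is exactly 2 J_t ([loss_grad_pairing]); the step
    size satisfies eta (eps + s_t^2) = 2 J_t, so the potential drops by at
    least eta J_t. Summing, sum_t eta J_t <= ln k, and the Cauchy-Schwarz
    inequality gives the regret bound ([sum_le_sqrt_of_weighted]).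

    The step inequality is a bound of Hoeffding type for the log-partition
    function: if H is symmetric with operator norm at most c, then
<<
    ln Tr e^(L+H) <= ln Tr e^L + Tr (H e^L) / Tr e^L + c^2 / 2
>>
    ([ln_mxtrace_expmx_le]). It is obtained without the Golden-Thompson
    inequality and without differentiating the matrix exponential. If A and B
    are symmetric, with eigenvalues a_i and b_j, then the traces of
    (A - B)^p e^A and (A - B)^p e^B for p <= 2 are sums over the pairs (i, j),
    weighted by the squared inner products of the eigenvectors, of
    (a_i - b_j)^p times e^(a_i) or e^(b_j) ([overlap_exists]). Inequalities
    between these traces reduce in this way to scalar ones, although A and B
    do not commute. Two are needed on the line x |-> L + x H. One is the
    Peierls-Bogoliubov inequality, by which the increment of ln Tr e^(L+xH)
    from x to y is at most (y - x) g y, where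
    g x = Tr (H e^(L+xH)) / Tr e^(L+xH). The other is
<<
    g y - g x <= (y - x) (c^2 - g x g y)     (x <= y),
>>
    which follows from the trapezoidal bound on the increments of exp
    ([gibbs_mean_steepness]). Cutting [0, 1] into n equal steps and letting n
    grow yields the bound ([increment_le_of_steepness]).

    The same overlap sums show that the exponential is injective on symmetric
    matrices, so the logarithm in the update recovers L_t from That_t. *)

(** * Frobenius inner product and Parseval frames *)

Lemma symmetricmxP (R : realType) (k : nat) (A : 'M[R]_k) :
  reflect (A^T = A) (A \is symmetricmx).
Proof.
apply: (iffP (is_hermitianmxP _ _ _)); rewrite expr0 scale1r map_mx_id //.
Qed.

Section Inner.
Context {R : realType}.
Implicit Types (p q k : nat).

Lemma frob_inner0r p q (X : 'M[R]_(p, q)) : frob_inner X 0 = 0.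
Proof. by rewrite /frob_inner mulmx0 linear0. Qed.

Lemma frob_inner_sumr p q (I : finType) (X : 'M[R]_(p, q))
    (Y : I -> 'M[R]_(p, q)) :
  frob_inner X (\sum_i Y i) = \sum_i frob_inner X (Y i).
Proof. by rewrite /frob_inner mulmx_sumr linear_sum. Qed.

Lemma frob_innerBl p q (X Y Z : 'M[R]_(p, q)) :
  frob_inner (X - Y) Z = frob_inner X Z - frob_inner Y Z.
Proof. by rewrite frob_innerC frob_innerBr !(frob_innerC Z). Qed.

Lemma frob_innerZl p q (a : R) (X Y : 'M[R]_(p, q)) :
  frob_inner (a *: X) Y = a * frob_inner X Y.
Proof. by rewrite frob_innerC frob_innerZr frob_innerC. Qed.

Lemma frob_inner_mulmxl p q k (A : 'M[R]_(p, k)) (X : 'M[R]_(k, q)) Y :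
  frob_inner (A *m X) Y = frob_inner X (A^T *m Y).
Proof. by rewrite /frob_inner trmx_mul mulmxA. Qed.

Lemma frob_inner_ge0 p q (X : 'M[R]_(p, q)) : 0 <= frob_inner X X.
Proof. by rewrite -sqr_frob_norm sqr_ge0. Qed.

Lemma frob_inner_eq0 p q (X : 'M[R]_(p, q)) : frob_inner X X = 0 -> X = 0.
Proof.
move=> XX0; apply/matrixP => i j; rewrite mxE.
have sum0 : \sum_j \sum_i X i j ^+ 2 = 0.
  rewrite -[RHS]XX0 /frob_inner /mxtrace; apply: eq_bigr => l _.
  by rewrite mxE; apply: eq_bigr => h _; rewrite mxE.
have ge0 l : 0 <= \sum_i X i l ^+ 2 by apply: sumr_ge0 => h _; exact: sqr_ge0.
have col0 := psumr_eq0P (fun l _ => ge0 l) sum0 (i := j) isT.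
have /eqP := psumr_eq0P (fun h _ => sqr_ge0 (X h j)) col0 (i := i) isT.
by rewrite sqrf_eq0 => /eqP.
Qed.

Lemma frob_inner_CS p q (X Y : 'M[R]_(p, q)) :
  frob_inner X Y ^+ 2 <= frob_inner X X * frob_inner Y Y.
Proof.
have [/eqP YY0|YY0] := boolP (frob_inner Y Y == 0).
  by rewrite (frob_inner_eq0 YY0) !frob_inner0r mulr0 expr0n.
have YYgt0 : 0 < frob_inner Y Y by rewrite lt_def YY0 frob_inner_ge0.
have := frob_inner_ge0 (frob_inner Y Y *: X - frob_inner X Y *: Y).
rewrite !(frob_innerBr, frob_innerBl, frob_innerZr, frob_innerZl).
rewrite (frob_innerC Y X) => h.
rewrite -subr_ge0 -(pmulr_rge0 _ YYgt0).
by lra.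
Qed.

Lemma frob_inner_mx11 k (x y : 'cV[R]_k) : frob_inner x y = (x^T *m y) 0 0.
Proof. by rewrite /frob_inner /mxtrace big_ord1. Qed.

(** The vectors may be more numerous than the dimension and need not be
    orthogonal: expansions of inner products and traces only use the
    resolution of the identity. *)
Definition parseval k (I : finType) (z : I -> 'cV[R]_k) :=
  \sum_i z i *m (z i)^T = 1%:M.

Lemma mul_col_trmx k (z x : 'cV[R]_k) :
  z *m z^T *m x = frob_inner z x *: z.
Proof.
by rewrite -mulmxA [z^T *m x]mx11_scalar mul_mx_scalar frob_inner_mx11.
Qed.

Lemma mxtrace_mul_col k (M : 'M[R]_k) (z : 'cV[R]_k) :
  \tr (M *m (z *m z^T)) = frob_inner z (M *m z).
Proof. by rewrite mulmxA mxtrace_mulC. Qed.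

Lemma parseval_inner k (I : finType) (z : I -> 'cV[R]_k) (x y : 'cV[R]_k) :
  parseval z -> frob_inner x y = \sum_i frob_inner (z i) x * frob_inner (z i) y.
Proof.
move=> zP; rewrite -{1}[y]mul1mx -zP mulmx_suml frob_inner_sumr.
apply: eq_bigr => i _.
by rewrite mul_col_trmx frob_innerZr mulrC [frob_inner x _]frob_innerC.
Qed.

Lemma parseval_mxtrace k (I : finType) (z : I -> 'cV[R]_k) (M : 'M[R]_k) :
  parseval z -> \tr M = \sum_i frob_inner (z i) (M *m z i).
Proof.
move=> zP; rewrite -{1}[M]mulmx1 -zP mulmx_sumr linear_sum /=.
by apply: eq_bigr => i _; rewrite mxtrace_mul_col.
Qed.

Lemma parseval_delta k : parseval (fun i : 'I_k => delta_mx i 0).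
Proof.
rewrite /parseval mx1_sum_delta; apply: eq_bigr => i _.
by rewrite trmx_delta mul_delta_mx.
Qed.

(** * Eigenframes of symmetric matrices *)

(** A redundant substitute for an orthonormal eigenbasis: it gives the same
    functional calculus, f(A) being the sum of the f(a_i) z_i z_i^T, and can be
    read off a complex diagonalization. *)
Record eigenframe k (A : 'M[R]_k) (I : finType) (a : I -> R)
    (z : I -> 'cV[R]_k) : Prop := Eigenframe {
  eigenframe_eigen : forall i, A *m z i = a i *: z i;
  eigenframe_parseval : parseval z }.

(** Over the complex numbers A is diagonalized by a unitary matrix P, with real
    eigenvalues. As A is real, the real and the imaginary parts of each row of
    P are eigenvectors of A, and the real part of P^* P = 1 says that these
    2k vectors resolve the identity. *)
Lemma eigenframe_exists k (A : 'M[R]_k) : A^T = A ->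
  exists (I : finType) (a : I -> R) (z : I -> 'cV[R]_k), eigenframe A a z.
Proof.
move=> Asym; pose AC : 'M[R[i]]_k := map_mx (real_complex R) A.
have ReD : {morph @complex.Re R : x y / x + y} by do 2 case=> ? ?.
have ImD : {morph @complex.Im R : x y / x + y} by do 2 case=> ? ?.
have ReM (x : R[i]) (y : R) :
  complex.Re (x * real_complex R y) = complex.Re x * y.
  by case: x => u v /=; rewrite mulr0 subr0.
have ImM (x : R[i]) (y : R) :
  complex.Im (x * real_complex R y) = complex.Im x * y.
  by case: x => u v /=; rewrite mulr0 add0r.
have AC_herm : AC \is hermsymmx.
  apply: realsym_hermsym.
    apply/is_hermitianmxP/matrixP => i j.
    by rewrite expr0 scale1r !mxE -{1}Asym mxE.
  by apply/mxOverP => i j; rewrite mxE; apply/complex_realP; eexists.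
pose P := spectralmx AC; pose D := spectral_diag AC.
have PU : P \is unitarymx := spectral_unitarymx _.
have PAE : P *m AC = diag_mx D *m P.
  have /orthomx_spectralP ACE := hermitian_normalmx AC_herm.
  rewrite {1}ACE !mulmxA.
  by rewrite mulmxV ?mul1mx // spectral_unit.
pose d i := complex.Re (D 0 i).
have dE i : D 0 i = real_complex R (d i).
  rewrite /d; have /mxOverP/(_ 0 i) := hermitian_spectral_diag_real AC_herm.
  by move=> /RRe_real ->.
pose X := map_mx (@complex.Re R) P; pose Y := map_mx (@complex.Im R) P.
have rowX i : A *m (row i X)^T = d i *: (row i X)^T.
  rewrite -{1}Asym -trmx_mul -linearZ /=; congr (_^T).
  apply/rowP => j; rewrite !mxE; have /matrixP/(_ i j) := PAE.
  rewrite mul_diag_mx !mxE dE => /(congr1 (@complex.Re R)).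
  rewrite (big_morph _ ReD (erefl : complex.Re (0 : R[i]) = 0)).
  rewrite mulrC ReM mulrC => <-.
  by apply: eq_bigr => l _; rewrite !mxE ReM.
have rowY i : A *m (row i Y)^T = d i *: (row i Y)^T.
  rewrite -{1}Asym -trmx_mul -linearZ /=; congr (_^T).
  apply/rowP => j; rewrite !mxE; have /matrixP/(_ i j) := PAE.
  rewrite mul_diag_mx !mxE dE => /(congr1 (@complex.Im R)).
  rewrite (big_morph _ ImD (erefl : complex.Im (0 : R[i]) = 0)).
  rewrite mulrC ImM mulrC => <-.
  by apply: eq_bigr => l _; rewrite !mxE ImM.
exists ('I_k + 'I_k)%type,
  (fun s => match s with inl i => d i | inr i => d i end),
  (fun s => match s with inl i => (row i X)^T | inr i => (row i Y)^T end).
split=> [[]//|]; rewrite /parseval big_sumType /= -big_split /=.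
have PtP : (P^t* *m P)%sesqui = 1%:M.
  by rewrite -invmx_unitary // mulVmx // spectral_unit.
apply/matrixP => i j; have /matrixP/(_ i j)/(congr1 (@complex.Re R)) := PtP.
rewrite !mxE (big_morph _ ReD (erefl : complex.Re (0 : R[i]) = 0)).
rewrite (_ : complex.Re (_ *+ _) = (i == j)%:R); last by case: (i == j).
move=> <-; rewrite summxE; apply: eq_bigr => l _.
rewrite !mxE !big_ord1 !mxE.
by case: (P l i) (P l j) => [u v] [s t] /=; ring.
Qed.

End Inner.

(** * The matrix exponential *)

Section Exponential.
Context {R : realType} {k : nat}.
Implicit Types A B H L : 'M[R]_k.

Lemma expmx_eigenframe A (I : finType) (a : I -> R) (z : I -> 'cV[R]_k) :
  eigenframe A a z -> expmx A = \sum_i expR (a i) *: (z i *m (z i)^T).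
Proof.
move=> [Az zP]; have powE n : A ^+ n = \sum_i a i ^+ n *: (z i *m (z i)^T).
  elim: n => [|n IHn]; first by under eq_bigr do rewrite expr0 scale1r.
  rewrite exprS IHn [LHS]mulmx_sumr; apply: eq_bigr => i _.
  by rewrite -scalemxAr mulmxA Az -scalemxAl scalerA mulrC -exprS.
apply: cvg_lim; first exact: norm_hausdorff.
have -> : series (fun n => (n`!%:R)^-1 *: A ^+ n) =
    (fun n => \sum_i series (exp_coeff (a i)) n *: (z i *m (z i)^T)).
  apply/funext => n; rewrite /series /=.
  under eq_bigr do rewrite powE scaler_sumr.
  rewrite exchange_big /=; apply: eq_bigr => i _; rewrite scaler_suml.
  by apply: eq_bigr => j _; rewrite scalerA mulrC.
apply: cvg_big => [|i _]; first exact: add_continuous.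
by apply: cvgZr_tmp; exact: is_cvg_series_exp_coeff.
Qed.

Lemma mxtrace_mul_expmx M A (I : finType) (a : I -> R) (z : I -> 'cV[R]_k) :
  eigenframe A a z ->
  \tr (M *m expmx A) = \sum_i expR (a i) * frob_inner (z i) (M *m z i).
Proof.
move=> /expmx_eigenframe ->; rewrite mulmx_sumr linear_sum /=.
by apply: eq_bigr => i _; rewrite -scalemxAr linearZ /= mxtrace_mul_col.
Qed.

Lemma mxtrace_expmx A (I : finType) (a : I -> R) (z : I -> 'cV[R]_k) :
  eigenframe A a z ->
  \tr (expmx A) = \sum_i expR (a i) * frob_inner (z i) (z i).
Proof.
move=> fA; rewrite -[expmx A]mul1mx (mxtrace_mul_expmx 1%:M fA).
by under eq_bigr do rewrite mul1mx.
Qed.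

(** The trace is a sum of nonnegative terms; if all vanished, so would every
    vector of the frame, whereas their squared norms add up to k. *)
Lemma mxtrace_expmx_gt0 A : (0 < k)%N -> A^T = A -> 0 < \tr (expmx A).
Proof.
move=> k_gt0 /eigenframe_exists[I [a [z fA]]].
rewrite (mxtrace_expmx fA) lt_def; apply/andP; split; last first.
  by apply: sumr_ge0 => i _; rewrite mulr_ge0 ?expR_ge0 ?frob_inner_ge0.
apply/eqP => sum0; have := parseval_mxtrace 1%:M (eigenframe_parseval fA).
rewrite mxtrace1 big1 => [/eqP|i _].
  by rewrite pnatr_eq0 -leqn0 leqNgt k_gt0.
rewrite mul1mx; apply/eqP.
have := psumr_eq0P _ sum0 (i := i) isT => /(_ _)/eqP; rewrite mulf_eq0.
rewrite gt_eqF ?expR_gt0 //=; apply => j _.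
by rewrite mulr_ge0 ?expR_ge0 ?frob_inner_ge0.
Qed.

Lemma expmx_scalar (g : R) :
  expmx (g%:M : 'M[R]_k) = expR g *: 1%:M.
Proof.
have fg : eigenframe (g%:M : 'M[R]_k) (fun=> g) (fun i : 'I_k => delta_mx i 0).
  by split=> [i|]; [rewrite mul_scalar_mx | exact: parseval_delta].
by rewrite (expmx_eigenframe fg) -scaler_sumr (eigenframe_parseval fg).
Qed.

Lemma expmxD_scalar A (g : R) : A^T = A ->
  expmx (A + g%:M) = expR g *: expmx A.
Proof.
move=> /eigenframe_exists[I [a [z fA]]].
have fAg : eigenframe (A + g%:M) (fun i => a i + g) z.
  split=> [i|]; last exact: eigenframe_parseval fA.
  by rewrite mulmxDl (eigenframe_eigen fA) mul_scalar_mx scalerDl.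
rewrite (expmx_eigenframe fAg) (expmx_eigenframe fA) scaler_sumr.
by apply: eq_bigr => i _; rewrite expRD scalerA mulrC.
Qed.

End Exponential.

(** * The spectral norm *)

Section SpectralNorm.
Context {R : realType} {k : nat}.

(** The coordinates of G x are the inner products of x with the rows of G, so
    the Frobenius norm of G bounds the set. *)
Lemma spectral_norm_has_sup (G : 'M[R]_k) :
  has_sup [set frob_norm (G *m x)
          | x in [set x : 'cV[R]_k | frob_norm x <= 1]]%classic.
Proof.
have norm0 : frob_norm (0 : 'cV[R]_k) = 0.
  by rewrite /frob_norm frob_inner0r sqrtr0.
split.
  by exists (frob_norm (G *m (0 : 'cV[R]_k))), 0 => //=; rewrite norm0.
pose y i : 'cV[R]_k := G^T *m delta_mx i 0.
pose M := \sum_i frob_inner (y i) (y i).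
exists (Num.sqrt M) => _ [x /= x1 <-].
apply: ler_wsqrtr; rewrite (parseval_inner _ _ (parseval_delta k)).
apply: ler_sum => i _.
rewrite [leLHS](_ : _ = frob_inner (y i) x ^+ 2); last first.
  by rewrite /y frob_inner_mulmxl trmxK expr2.
apply: (le_trans (frob_inner_CS _ _)); rewrite ler_piMr ?frob_inner_ge0 //.
by rewrite -sqr_frob_norm expr_le1 // sqrtr_ge0.
Qed.

Lemma spectral_norm_ge0 (G : 'M[R]_k) : 0 <= spectral_norm G.
Proof.
apply: ub_le_sup; first by case: (spectral_norm_has_sup G).
exists 0 => /=; first by rewrite /frob_norm frob_inner0r sqrtr0.
by rewrite mulmx0 /frob_norm frob_inner0r sqrtr0.
Qed.

Lemma spectral_norm_mul (G : 'M[R]_k) (x : 'cV[R]_k) :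
  frob_inner (G *m x) (G *m x) <= spectral_norm G ^+ 2 * frob_inner x x.
Proof.
have [/eqP/frob_inner_eq0 ->|xx0] := boolP (frob_inner x x == 0).
  by rewrite mulmx0 !frob_inner0r mulr0.
have xx_gt0 : 0 < frob_inner x x by rewrite lt_def xx0 frob_inner_ge0.
pose s := frob_norm x; have s_gt0 : 0 < s by rewrite sqrtr_gt0.
have s2 : s ^+ 2 = frob_inner x x by rewrite sqr_frob_norm.
have : frob_norm (G *m (s^-1 *: x)) <= spectral_norm G.
  apply: ub_le_sup; first by case: (spectral_norm_has_sup G).
  exists (s^-1 *: x) => //=; rewrite /frob_norm frob_innerZl frob_innerZr -s2.
  by rewrite mulrA -invfM -expr2 mulVf ?expf_eq0 ?gt_eqF // sqrtr1.
rewrite -(ler_pXn2r (n := 2)) ?nnegrE ?sqrtr_ge0 ?spectral_norm_ge0 //.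
rewrite sqr_frob_norm -scalemxAr frob_innerZl frob_innerZr mulrA -invfM -expr2.
by rewrite ler_pdivrMl ?exprn_gt0 // s2 mulrC.
Qed.

Lemma spectral_norm_eq0 (G : 'M[R]_k) : spectral_norm G = 0 -> G = 0.
Proof.
move=> G0; have Gx0 (x : 'cV[R]_k) : G *m x = 0.
  apply: frob_inner_eq0; apply/eqP; rewrite eq_le frob_inner_ge0 andbT.
  by have := spectral_norm_mul G x; rewrite G0 expr0n mul0r.
rewrite -[G]mulmx1 -(parseval_delta k) mulmx_sumr; apply: big1 => i _.
by rewrite mulmxA Gx0 mul0mx.
Qed.

End SpectralNorm.

(** * Scalar inequalities *)

Section ScalarInequalities.
Context {R : realType}.
Implicit Types (x y : R).

(** The difference of the sides vanishes at 0 and has derivative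
    1 + s e^s - e^s, which is nonnegative because 1 - s <= e^(-s). *)
Lemma expR_trapezoid_ge0 (t : R) :
  0 <= t -> 2 * (expR t - 1) <= t * (expR t + 1).
Proof.
move=> t_ge0; pose f (s : R) := s * (expR s + 1) - 2 * (expR s - 1).
have df (s : R) : is_derive s 1 f (1 + s * expR s - expR s).
  by rewrite /f; apply: is_derive_eq; rewrite /GRing.scale /=; ring.
suff : f 0 <= f t by rewrite /f expR0 subrr mulr0 mul0r subr0 subr_ge0.
apply: (@ger0_derive1_ndecr R f 0 t) => // [s|].
  rewrite in_itv /= => /andP[s_gt0 _]; rewrite derive1E derive_val.
  have := expR_ge1Dx (- s); rewrite expRN => /(ler_wpM2r (expR_ge0 s)).
  rewrite mulVf ?gt_eqF ?expR_gt0 // => h; lra.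
apply: continuous_subspaceT => s; apply: differentiable_continuous.
by apply/derivable1_diffP; apply: ex_derive.
Qed.

(** By convexity, the mean of exp between y and x is at most the mean of its
    values at the end points. *)
Lemma expR_trapezoid x y :
  (x - y) * (expR x - expR y) <= (x - y) ^+ 2 * (expR x + expR y) / 2.
Proof.
wlog le_yx : x y / y <= x => [hw|].
  have [/hw //|/ltW /hw] := leP y x; set u := expR x; set v := expR y => h.
  by lra.
have := expR_trapezoid_ge0 (t := x - y); rewrite subr_ge0 => /(_ le_yx).
set u := expR x; set v := expR y; have v_gt0 : 0 < v := expR_gt0 y.
have uvK : u / v * v = u by rewrite divfK ?gt_eqF.
rewrite expRD expRN -/u -/v => /(ler_wpM2r (ltW v_gt0)) h.
have xy_ge0 : 0 <= x - y by rewrite subr_ge0.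
have := ler_wpM2l xy_ge0 h; move: (u / v) uvK => r rE {h}; nra.
Qed.

(** For u = a or u = b, these are the unnormalized moments of a - b under the
    weights w e^u. *)
Definition exp_moment (I : finType) (w a b : I -> R) (p : nat) (u : I -> R) :=
  \sum_i w i * (a i - b i) ^+ p * expR (u i).

(** Divided by the two moments of order 0, the left-hand side is the increase
    of the mean of Y = a - b when the weights w e^b are tilted by e^Y. Twice
    the left-hand side is the double sum over i and j of
    w_i w_j (Y_i - Y_j) (e^(a_i + b_j) - e^(b_i + a_j)). The exponents differ
    by exactly Y_i - Y_j, so the trapezoidal bound applies to each term;
    expanding (Y_i - Y_j)^2 gives the right-hand side, whose product of first
    moments comes from the cross term. *)
Lemma exp_moment_increment (I : finType) (w a b : I -> R) :
  (forall i, 0 <= w i) ->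
  exp_moment w a b 1 a * exp_moment w a b 0 b
      - exp_moment w a b 0 a * exp_moment w a b 1 b
    <= (exp_moment w a b 2 a * exp_moment w a b 0 b
         + exp_moment w a b 0 a * exp_moment w a b 2 b) / 2
       - exp_moment w a b 1 a * exp_moment w a b 1 b.
Proof.
move=> w_ge0; set m := exp_moment w a b.
pose t p u i := w i * (a i - b i) ^+ p * expR (u i).
(* U is not symmetric in i and j; only U i j + U j i is nonnegative. *)
pose U i j := t 2%N a i * t 0%N b j + t 0%N a i * t 2%N b j
  + -2 * t 1%N a i * t 1%N b j + -2 * t 1%N a i * t 0%N b j
  + 2 * t 0%N a i * t 1%N b j.
have sumU : \sum_i \sum_j U i j = m 2%N a * m 0%N b + m 0%N a * m 2%N b
    - 2 * (m 1%N a * m 1%N b) - 2 * (m 1%N a * m 0%N b)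
    + 2 * (m 0%N a * m 1%N b).
  under eq_bigr do rewrite !big_split /=.
  rewrite !big_split /= -!big_distrlr /= -!mulr_sumr.
  have mE p u : \sum_i t p u i = m p u by [].
  by rewrite !mE; ring.
suff : 0 <= \sum_i \sum_j U i j by rewrite sumU; lra.
suff : 0 <= \sum_i \sum_j (U i j + U j i).
  under eq_bigr do rewrite big_split /=.
  by rewrite big_split /= [X in _ + X]exchange_big /= -mulr2n pmulrn_lge0.
apply: sumr_ge0 => i _; apply: sumr_ge0 => j _.
have := expR_trapezoid (a i + b j) (b i + a j); rewrite !expRD => h.
have := ler_wpM2l (mulr_ge0 (w_ge0 i) (w_ge0 j)) h.
rewrite /U /t !expr0 !expr1 -subr_ge0 => /(mulr_ge0 (ler0n R 2)) {}h.
by lra.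
Qed.

(** The first two hypotheses say in discrete form that p' = g and
    g' <= c^2 - g^2 <= c^2; the conclusion is then a second-order Taylor
    bound. On a step of length d = y - x, the product g x g y may be slightly
    negative, but it is at least - (g y - g x)^2 / 4, and |g| <= c turns this
    into (g y - g x) (1 - d c / 2) <= d c^2. Summing twice over n steps of
    length 1 / n loses only a relative error of order 1 / n. *)
Lemma increment_le_of_steepness (p g : R -> R) (c : R) : 0 <= c ->
  (forall x y, p y - p x <= (y - x) * g y) ->
  (forall x y, x <= y -> g y - g x <= (y - x) * (c ^+ 2 - g x * g y)) ->
  (forall x, `|g x| <= c) -> p 1 - p 0 <= g 0 + c ^+ 2 / 2.
Proof.
move=> c_ge0 pg g_incr g_bnd.
have g_mono x y : x <= y -> g x <= g y.
  rewrite le_eqVlt => /predU1P[->//|lt_xy].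
  have := pg x y; have := pg y x => h1 h2.
  have : 0 <= (y - x) * (g y - g x) by lra.
  by rewrite pmulr_rge0 ?subr_gt0 // subr_ge0.
pose C := c / 2.
have step x y : x <= y -> (g y - g x) * (1 - (y - x) * C) <= (y - x) * c ^+ 2.
  move=> le_xy; have := g_incr x y le_xy.
  have := g_mono x y le_xy; have := g_bnd x; have := g_bnd y.
  rewrite !ler_norml => /andP[y1 y2] /andP[x1 x2] mono incr.
  have u_ge0 : 0 <= (g y - g x) * (2 * c - (g y - g x)).
    by apply: mulr_ge0; lra.
  have u2_ge0 := sqr_ge0 (g x + g y).
  have inner : 0 <= g x * g y + (g y - g x) * C by rewrite /C; lra.
  have d_ge0 : 0 <= y - x by rewrite subr_ge0.
  have := mulr_ge0 d_ge0 inner; lra.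
have slope n : (0 < n)%N -> forall j,
    (g (j%:R / n%:R) - g 0) * (1 - C / n%:R) <= j%:R / n%:R * c ^+ 2.
  move=> n_gt0; elim=> [|j IHj]; first by rewrite !mul0r subrr mul0r.
  have := step (j%:R / n%:R) (j.+1%:R / n%:R).
  rewrite ler_pM2r ?invr_gt0 ?ltr0n // ler_nat leqnSn => /(_ isT).
  rewrite -(natr1 j); set N := n%:R^-1 in IHj *; set v := j%:R in IHj *; lra.
pose D := p 1 - p 0 - g 0.
have total n : (0 < n)%N -> C <= n%:R -> forall j,
    (p (j%:R / n%:R) - p 0 - j%:R / n%:R * g 0) * (1 - C / n%:R)
    <= n%:R^-1 ^+ 2 * (j%:R * (j%:R + 1) / 2) * c ^+ 2.
  move=> n_gt0 leCn; elim=> [|j IHj].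
    by rewrite !mul0r mulr0 !mul0r !subrr mul0r.
  have := pg (j%:R / n%:R) (j.+1%:R / n%:R).
  have := slope n n_gt0 j.+1.
  have : 0 <= 1 - C / n%:R by rewrite subr_ge0 ler_pdivrMr ?ltr0n ?mul1r.
  have : 0 < (n%:R : R)^-1 by rewrite invr_gt0 ltr0n.
  move: IHj; rewrite -(natr1 j); set N := n%:R^-1; set v := j%:R.
  set pX := p (v * N); set gY := g ((v + 1) * N); set pY := p ((v + 1) * N).
  move=> IHj N_gt0 CN gYle pYle.
  have : (pY - p 0 - (v + 1) * N * g 0) * (1 - C * N) <=
      (pX - p 0 - v * N * g 0 + N * (gY - g 0)) * (1 - C * N).
    by apply: ler_wpM2r => //; lra.
  have := ler_wpM2l (ltW N_gt0) gYle; lra.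
rewrite -lerBlDl -/D leNgt; apply/negP => ltD.
have e_gt0 : 0 < D - c ^+ 2 / 2 by rewrite subr_gt0.
have C_ge0 : 0 <= C by rewrite divr_ge0.
have c2_ge0 : 0 <= c ^+ 2 / 2 by rewrite divr_ge0 ?sqr_ge0.
(* With D the excess over the first-order term, total at j = n reads
   n (D - c^2 / 2) <= D C + c^2 / 2, which fails as soon as n > q. *)
pose q := (D * C + c ^+ 2 / 2) / (D - c ^+ 2 / 2).
have q_ge0 : 0 <= q.
  apply: divr_ge0; last exact: ltW.
  by rewrite addr_ge0 // mulr_ge0 // (le_trans c2_ge0) // ltW.
pose n := Num.bound (C + q).
have n_gt : C + q < n%:R by apply: archi_boundP; rewrite addr_ge0.
have nR_gt0 : 0 < n%:R :> R by apply: le_lt_trans n_gt; rewrite addr_ge0.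
have n_gt0 : (0 < n)%N by rewrite -(ltr0n R).
have := total n n_gt0 _ n; rewrite divff ?gt_eqF // mul1r -/D.
move=> /(_ (ltW (le_lt_trans _ n_gt))); rewrite lerDl => /(_ q_ge0).
move=> /(ler_wpM2l (ltW nR_gt0)).
have -> : n%:R * (D * (1 - C / n%:R)) = n%:R * D - D * C.
  by field; rewrite gt_eqF.
have -> : n%:R * (n%:R^-1 ^+ 2 * (n%:R * (n%:R + 1) / 2) * c ^+ 2)
    = (n%:R + 1) * (c ^+ 2 / 2) by field; rewrite gt_eqF.
have : q < n%:R by apply: le_lt_trans n_gt; rewrite lerDr.
by rewrite ltr_pdivrMr //; lra.
Qed.

End ScalarInequalities.

(** * Comparing two symmetric matrices through their overlaps *)

Section Overlap.
Context {R : realType} {k : nat}.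
Implicit Types A B H L : 'M[R]_k.

(** A acts on x i by the scalar a i and, B being symmetric, B acts inside the
    inner product with y j by b j; so A - B has the overlap coefficient
    (a i - b j) <y j, x i>, and Parseval's identity for y concludes. This
    stops at p = 2 because (A - B)^2 is split evenly between the two sides. *)
Lemma eigenframe_diff_moment A B (I J : finType) (a : I -> R) (b : J -> R)
    (x : I -> 'cV[R]_k) (y : J -> 'cV[R]_k) (i : I) (p : nat) :
  A^T = A -> B^T = B -> eigenframe A a x -> eigenframe B b y -> (p <= 2)%N ->
  frob_inner (x i) ((A - B) ^+ p *m x i)
    = \sum_j frob_inner (y j) (x i) ^+ 2 * (a i - b j) ^+ p.
Proof.
move=> Asym Bsym fA fB.
have dE j : frob_inner (y j) ((A - B) *m x i)
    = (a i - b j) * frob_inner (y j) (x i).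
  rewrite mulmxBl frob_innerBr (eigenframe_eigen fA) frob_innerZr mulrBl.
  by rewrite -{1}Bsym -frob_inner_mulmxl (eigenframe_eigen fB) frob_innerZl.
have yP := eigenframe_parseval fB.
case: p => [|[|[|//]]] _.
- rewrite expr0 mul1mx (parseval_inner _ _ yP).
  by apply: eq_bigr => j _; rewrite expr0 mulr1 expr2.
- rewrite expr1 (parseval_inner _ _ yP); apply: eq_bigr => j _.
  by rewrite dE; ring.
rewrite expr2 -mulmxA -{1}[A - B]trmxK -frob_inner_mulmxl linearB /= Asym Bsym.
by rewrite (parseval_inner _ _ yP); apply: eq_bigr => j _; rewrite dE; ring.
Qed.

(** The indices stand for pairs of eigenvectors, one of A and one of B, and the
    weights for their squared inner products. *)
Record overlap A B (K : finType) (w a b : K -> R) : Prop := Overlap {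
  overlap_ge0 : forall l, 0 <= w l;
  overlap_sqr : \tr ((A - B) ^+ 2) = \sum_l w l * (a l - b l) ^+ 2;
  overlap_l : forall p, (p <= 2)%N ->
    \tr ((A - B) ^+ p *m expmx A) = exp_moment w a b p a;
  overlap_r : forall p, (p <= 2)%N ->
    \tr ((A - B) ^+ p *m expmx B) = exp_moment w a b p b }.

Lemma overlap_exists A B : A^T = A -> B^T = B ->
  exists (K : finType) (w a b : K -> R), overlap A B w a b.
Proof.
move=> Asym Bsym.
have [I [a [x fA]]] := eigenframe_exists Asym.
have [J [b [y fB]]] := eigenframe_exists Bsym.
exists (I * J)%type, (fun l => frob_inner (y l.2) (x l.1) ^+ 2),
  (fun l => a l.1), (fun l => b l.2).
split=> [l||p p2|p p2]; first exact: sqr_ge0.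
- rewrite (parseval_mxtrace _ (eigenframe_parseval fA)).
  rewrite -(pair_bigA _ (fun i j =>
    frob_inner (y j) (x i) ^+ 2 * (a i - b j) ^+ 2)) /=.
  by apply: eq_bigr => i _; rewrite (eigenframe_diff_moment i Asym Bsym fA fB).
- rewrite (mxtrace_mul_expmx _ fA) /exp_moment -(pair_bigA _ (fun i j =>
    frob_inner (y j) (x i) ^+ 2 * (a i - b j) ^+ p * expR (a i))) /=.
  apply: eq_bigr => i _; rewrite (eigenframe_diff_moment i Asym Bsym fA fB) //.
  by rewrite mulrC mulr_suml.
rewrite (mxtrace_mul_expmx _ fB) /exp_moment -(pair_bigA _ (fun i j =>
    frob_inner (y j) (x i) ^+ 2 * (a i - b j) ^+ p * expR (b j))).
rewrite exchange_big /=.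
apply: eq_bigr => j _.
have -> : (A - B) ^+ p = (-1) ^+ p *: (B - A) ^+ p.
  case: p p2 => [|[|[|//]]] _; first by rewrite !expr0 scale1r.
    by rewrite !expr1 scaleN1r opprB.
  by rewrite -(opprB B) !sqrrN expr1n scale1r.
rewrite -scalemxAl frob_innerZr (eigenframe_diff_moment j Bsym Asym fB fA) //.
rewrite mulrC mulr_sumr mulr_suml; apply: eq_bigr => i _.
rewrite frob_innerC -(opprB (b j)) -[- (b j - a i)]mulN1r exprMn.
by rewrite mulrCA -!mulrA.
Qed.

(** The trace of (A - B) (e^A - e^B) is a weighted sum of the nonnegative terms
    (a - b) (e^a - e^b). If it vanishes, then a = b wherever the weight is not
    zero, so Tr (A - B)^2, the squared norm of A - B, vanishes too. *)
Lemma expmx_sym_inj A B : A^T = A -> B^T = B -> expmx A = expmx B -> A = B.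
Proof.
move=> Asym Bsym eqE; have [K [w [a [b ov]]]] := overlap_exists Asym Bsym.
have sum0 : \sum_l w l * ((a l - b l) * (expR (a l) - expR (b l))) = 0.
  have := overlap_l ov (p := 1) isT; rewrite eqE (overlap_r ov (p := 1)) //.
  move=> /eqP; rewrite eq_sym -subr_eq0 -sumrB => /eqP sum0.
  by rewrite -[RHS]sum0; apply: eq_bigr => l _; rewrite !expr1; ring.
apply/eqP; rewrite -subr_eq0; apply/eqP/frob_inner_eq0.
have -> : frob_inner (A - B) (A - B) = \tr ((A - B) ^+ 2).
  by rewrite /frob_inner [(A - B)^T]linearB /= Asym Bsym expr2.
rewrite (overlap_sqr ov); apply: big1 => l _.
have ge0 (i : K) : 0 <= w i * ((a i - b i) * (expR (a i) - expR (b i))).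
  apply: mulr_ge0; first exact: overlap_ge0 ov i.
  have [le_ab|/ltW le_ba] := leP (a i) (b i).
    by rewrite mulr_le0 ?subr_le0 ?ler_expR.
  by rewrite mulr_ge0 ?subr_ge0 ?ler_expR.
have /eqP := psumr_eq0P (fun i _ => ge0 i) sum0 (i := l) isT.
rewrite !mulf_eq0 !subr_eq0 (inj_eq (@expR_inj R)) orbb => /orP[]/eqP->.
  by rewrite mul0r.
by rewrite subrr expr0n mulr0.
Qed.

Lemma trmx_expmx A : A^T = A -> (expmx A)^T = expmx A.
Proof.
move=> /eigenframe_exists[I [a [z fA]]].
rewrite (expmx_eigenframe fA) linear_sum /=; apply: eq_bigr => i _.
by rewrite linearZ /= trmx_mul trmxK.
Qed.

Lemma lnmx_expmx L : L^T = L -> lnmx (expmx L) = L.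
Proof.
move=> Lsym; rewrite /lnmx.
case: xgetP => [M _ [/symmetricmxP Msym eqE]|/(_ L)].
  exact: expmx_sym_inj.
by case; split=> //; apply/symmetricmxP.
Qed.
End Overlap.

(** * The log-partition function *)

(** Normalization of [exp_moment_increment] on a segment of length d, where
    the second moments are at most c^2 times the masses. *)
Lemma mean_steepness_of_moments (R : realType) (c a0 a1 a2 b0 b1 b2 d : R) :
  0 < d -> 0 < b0 -> 0 < a0 -> b2 <= c ^+ 2 * b0 -> a2 <= c ^+ 2 * a0 ->
  d * a1 * b0 - a0 * (d * b1)
    <= (d ^+ 2 * a2 * b0 + a0 * (d ^+ 2 * b2)) / 2 - d * a1 * (d * b1) ->
  a1 / a0 - b1 / b0 <= d * (c ^+ 2 - b1 / b0 * (a1 / a0)).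
Proof.
move=> d_gt0 b0_gt0 a0_gt0 b2le a2le incr.
have ab_gt0 : 0 < a0 * b0 by rewrite mulr_gt0.
rewrite -(ler_pM2r ab_gt0) -(ler_pM2l d_gt0).
have -> : d * ((a1 / a0 - b1 / b0) * (a0 * b0)) = d * a1 * b0 - a0 * (d * b1).
  by field; rewrite !gt_eqF.
apply: le_trans incr _.
have -> : d * (d * (c ^+ 2 - b1 / b0 * (a1 / a0)) * (a0 * b0))
    = d ^+ 2 * (c ^+ 2 * (a0 * b0) - a1 * b1).
  by field; rewrite !gt_eqF.
have := ler_wpM2r (ltW b0_gt0) a2le; have := ler_wpM2r (ltW a0_gt0) b2le.
move=> h1 h2; have := ler_wpM2l (sqr_ge0 d) (lerD h1 h2); lra.
Qed.

Section Gibbs.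
Context {R : realType} {k : nat}.
Implicit Types A B H L M : 'M[R]_k.

Lemma sym_affine L H (x : R) :
  L^T = L -> H^T = H -> (L + x *: H)^T = L + x *: H.
Proof. by move=> Lsym Hsym; rewrite linearD linearZ /= Lsym Hsym. Qed.

Definition gibbs_mean H A := \tr (H *m expmx A) / \tr (expmx A).

(** Jensen's inequality for exp under the weights w e^b: the mean of e^(a - b)
    is at least e^m, where m is the mean of a - b. *)
Lemma peierls_bogoliubov A B : (0 < k)%N -> A^T = A -> B^T = B ->
  gibbs_mean (A - B) B <= ln (\tr (expmx A)) - ln (\tr (expmx B)).
Proof.
move=> k_gt0 Asym Bsym; set m := gibbs_mean _ _.
have A_gt0 := mxtrace_expmx_gt0 k_gt0 Asym.
have B_gt0 := mxtrace_expmx_gt0 k_gt0 Bsym.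
rewrite lerBrDr -[m]expRK -lnM ?posrE ?expR_gt0 //.
rewrite ler_ln ?posrE ?mulr_gt0 ?expR_gt0 //.
have [K [w [a [b ov]]]] := overlap_exists Asym Bsym.
have E0A := overlap_l ov (p := 0) isT; have E0B := overlap_r ov (p := 0) isT.
have E1 := overlap_r ov (p := 1) isT.
rewrite !expr0 !expr1 !mul1mx in E0A E0B E1.
have meanE : exp_moment w a b 1 b - m * exp_moment w a b 0 b = 0.
  by rewrite -E1 -E0B /m /gibbs_mean divfK ?subrr // gt_eqF.
have -> : expR m * \tr (expmx B)
    = expR m * (exp_moment w a b 0 b
        + (exp_moment w a b 1 b - m * exp_moment w a b 0 b)).
  by rewrite meanE addr0 -E0B.
(* Termwise, e^(a - b) >= e^m (1 + (a - b - m)); the linear part sums to 0. *)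
rewrite E0A /exp_moment [m * _]mulr_sumr -sumrB -big_split /= mulr_sumr.
apply: ler_sum => l _; rewrite !expr0 !expr1 !mulr1.
have -> : expR (a l) = expR (b l) * expR m * expR (a l - b l - m).
  by rewrite -!expRD; congr expR; ring.
have := expR_ge1Dx (a l - b l - m).
have wb_ge0 : 0 <= w l * expR (b l) * expR m.
  by rewrite !mulr_ge0 ?expR_ge0 // (overlap_ge0 ov).
by move=> /(ler_wpM2l wb_ge0); lra.
Qed.

Definition op_bounded H (c : R) :=
  forall x : 'cV[R]_k, frob_inner (H *m x) (H *m x) <= c ^+ 2 * frob_inner x x.

Lemma mxtrace_sqr_expmx_le H A (c : R) : H^T = H -> A^T = A -> op_bounded H c ->
  \tr (H ^+ 2 *m expmx A) <= c ^+ 2 * \tr (expmx A).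
Proof.
move=> Hsym /eigenframe_exists[I [a [z fA]]] Hc.
rewrite (mxtrace_mul_expmx _ fA) (mxtrace_expmx fA) mulr_sumr.
apply: ler_sum => i _.
rewrite mulrCA ler_wpM2l ?expR_ge0 // expr2 -mulmxA -{1}Hsym -frob_inner_mulmxl.
exact: Hc.
Qed.

Lemma gibbs_mean_bounded H A (c : R) : (0 < k)%N -> A^T = A -> 0 <= c ->
  op_bounded H c -> `|gibbs_mean H A| <= c.
Proof.
move=> k_gt0 Asym c_ge0 Hc; have A_gt0 := mxtrace_expmx_gt0 k_gt0 Asym.
rewrite normrM normfV (gtr0_norm A_gt0) ler_pdivrMr //.
have [I [a [z fA]]] := eigenframe_exists Asym.
rewrite (mxtrace_mul_expmx _ fA) (mxtrace_expmx fA) mulr_sumr.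
apply: le_trans (ler_norm_sum _ _ _) _; apply: ler_sum => i _.
rewrite normrM ger0_norm ?expR_ge0 // mulrCA ler_wpM2l ?expR_ge0 //.
rewrite -ler_sqr ?nnegrE ?mulr_ge0 ?frob_inner_ge0 // real_normK ?num_real //.
apply: le_trans (frob_inner_CS _ _) _.
rewrite exprMn [_ ^+ 2 in leRHS]expr2 mulrCA -expr2.
by rewrite ler_wpM2l ?frob_inner_ge0.
Qed.

Lemma mxtrace_exprZ_mul (d : R) H M (p : nat) :
  \tr ((d *: H) ^+ p *m M) = d ^+ p * \tr (H ^+ p *m M).
Proof.
have -> : (d *: H) ^+ p = d ^+ p *: H ^+ p.
  elim: p => [|p IHp]; first by rewrite !expr0 scale1r.
  rewrite exprS IHp -[LHS]/((d *: H) *m (d ^+ p *: H ^+ p)).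
  by rewrite -scalemxAl -scalemxAr scalerA -exprS [H ^+ p.+1]exprS.
by rewrite -scalemxAl mxtraceZ.
Qed.

Lemma gibbs_mean_steepness L H (c x y : R) : (0 < k)%N ->
  L^T = L -> H^T = H -> op_bounded H c -> x <= y ->
  gibbs_mean H (L + y *: H) - gibbs_mean H (L + x *: H)
    <= (y - x) *
       (c ^+ 2 - gibbs_mean H (L + x *: H) * gibbs_mean H (L + y *: H)).
Proof.
move=> k_gt0 Lsym Hsym Hc; rewrite le_eqVlt => /predU1P[->|lt_xy].
  by rewrite !subrr mul0r.
have Asym := sym_affine y Lsym Hsym; have Bsym := sym_affine x Lsym Hsym.
have : L + y *: H - (L + x *: H) = (y - x) *: H.
  by rewrite opprD addrACA subrr add0r -scalerBl.
move: (L + y *: H) (L + x *: H) Asym Bsym => A B Asym Bsym ABE.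
have [K [w [a [b ov]]]] := overlap_exists Asym Bsym.
have momA p : (p <= 2)%N ->
    exp_moment w a b p a = (y - x) ^+ p * \tr (H ^+ p *m expmx A).
  by move=> p2; rewrite -(overlap_l ov p2) ABE mxtrace_exprZ_mul.
have momB p : (p <= 2)%N ->
    exp_moment w a b p b = (y - x) ^+ p * \tr (H ^+ p *m expmx B).
  by move=> p2; rewrite -(overlap_r ov p2) ABE mxtrace_exprZ_mul.
have := exp_moment_increment a b (overlap_ge0 ov).
rewrite (momA 0) // (momA 1) // (momA 2) // (momB 0) // (momB 1) // (momB 2) //.
rewrite !expr0 !expr1 !mul1r !mul1mx.
apply: mean_steepness_of_moments.
- by rewrite subr_gt0.
- exact: mxtrace_expmx_gt0.
- exact: mxtrace_expmx_gt0.
- exact: mxtrace_sqr_expmx_le.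
- exact: mxtrace_sqr_expmx_le.
Qed.

(** A noncommutative Hoeffding lemma: x |-> ln Tr e^(L + x H) has derivative
    the Gibbs mean of H, whose slope is at most c^2. *)
Lemma ln_mxtrace_expmx_le L H (c : R) : (0 < k)%N ->
  L^T = L -> H^T = H -> 0 <= c -> op_bounded H c ->
  ln (\tr (expmx (L + H))) - ln (\tr (expmx L)) <= gibbs_mean H L + c ^+ 2 / 2.
Proof.
move=> k_gt0 Lsym Hsym c_ge0 Hc.
have := @increment_le_of_steepness R (fun x => ln (\tr (expmx (L + x *: H))))
  (fun x => gibbs_mean H (L + x *: H)) c c_ge0.
rewrite /= scale1r scale0r addr0; apply => [x y|x y|x].
- have := @peierls_bogoliubov (L + x *: H) (L + y *: H) k_gt0.
  rewrite !sym_affine // => /(_ erefl erefl).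
  rewrite opprD addrACA subrr add0r -scalerBl /gibbs_mean -scalemxAl mxtraceZ.
  rewrite -mulrA; move: (ln _) (ln _) (_ / _) => u v m; lra.
- exact: gibbs_mean_steepness.
- exact: (gibbs_mean_bounded k_gt0 (sym_affine x Lsym Hsym) c_ge0 Hc).
Qed.

(** The logarithm of a density matrix e^L is negative semidefinite, since
    L <= e^L - I, and e^L <= I because each eigenvalue of e^L is at most its
    trace. *)
Lemma log_density_le0 L (x : 'cV[R]_k) : L^T = L -> \tr (expmx L) = 1 ->
  frob_inner x (L *m x) <= 0.
Proof.
move=> Lsym trL; have [I [b [z fL]]] := eigenframe_exists Lsym.
have zP := eigenframe_parseval fL.
have -> : frob_inner x (L *m x) = \sum_i b i * frob_inner (z i) x ^+ 2.
  rewrite (parseval_inner _ _ zP); apply: eq_bigr => i _.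
  rewrite -{1}Lsym -frob_inner_mulmxl (eigenframe_eigen fL) frob_innerZl; ring.
suff : \sum_i (1 + b i) * frob_inner (z i) x ^+ 2 <= frob_inner x x.
  have -> : frob_inner x x = \sum_i frob_inner (z i) x ^+ 2.
    by rewrite (parseval_inner _ _ zP); apply: eq_bigr => i _; rewrite expr2.
  rewrite -subr_le0 -sumrB.
  by under eq_bigr do rewrite mulrDl mul1r addrAC subrr add0r.
have -> : frob_inner x x = \tr (expmx L) * frob_inner x x.
  by rewrite trL mul1r.
rewrite (mxtrace_expmx fL) mulr_suml; apply: ler_sum => i _.
apply: (@le_trans _ _ (expR (b i) * frob_inner (z i) x ^+ 2)).
  by rewrite ler_wpM2r ?sqr_ge0 ?expR_ge1Dx.
by rewrite -mulrA ler_wpM2l ?expR_ge0 ?frob_inner_CS.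
Qed.

Lemma mxtrace_mul_psd_le0 Q L : psdmx Q -> L^T = L ->
  (forall x : 'cV[R]_k, frob_inner x (L *m x) <= 0) -> \tr (Q *m L) <= 0.
Proof.
move=> [_ Qpsd] Lsym Lneg; have [I [b [z fL]]] := eigenframe_exists Lsym.
rewrite (parseval_mxtrace _ (eigenframe_parseval fL)); apply: sumr_le0 => i _.
rewrite -mulmxA (eigenframe_eigen fL) -scalemxAr frob_innerZr.
have Qz : 0 <= frob_inner (z i) (Q *m z i) by rewrite frob_inner_mx11 mulmxA.
have := Lneg (z i); rewrite (eigenframe_eigen fL) frob_innerZr.
have [b_le0 _|b_gt0] := leP (b i) 0; first by rewrite mulr_le0_ge0.
rewrite pmulr_rle0 // => zz_le0.
have /frob_inner_eq0 -> : frob_inner (z i) (z i) = 0.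
  by apply/eqP; rewrite eq_le zz_le0 frob_inner_ge0.
by rewrite mulmx0 frob_inner0r mulr0.
Qed.

(** Normalizing e^(L - eta S) subtracts ln Z from the logarithm, where Z is its
    trace, so - Tr (Theta L) grows by eta Tr (Theta S) + ln Z. The bound on
    ln Z with H = - eta S and c = |eta| |S| contributes - eta Tr (e^L S) and
    the quadratic error. *)
Lemma exp_gradient_step L S Theta (eta : R) : (0 < k)%N ->
  L^T = L -> S^T = S -> \tr (expmx L) = 1 -> \tr Theta = 1 ->
  let E := expmx (L - eta *: S) in
  exists L', [/\ L'^T = L', expmx L' = (\tr E)^-1 *: E, \tr (expmx L') = 1 &
    - \tr (Theta *m L') <= - \tr (Theta *m L)
      - eta * \tr ((expmx L - Theta) *m S) + (eta * spectral_norm S) ^+ 2 / 2].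
Proof.
move=> k_gt0 Lsym Ssym trL trTheta; set E := expmx (L - eta *: S).
have Hsym : (- eta *: S)^T = - eta *: S by rewrite linearZ /= Ssym.
have LHsym : (L - eta *: S)^T = L - eta *: S.
  by rewrite -scaleNr; exact: sym_affine.
have E_gt0 : 0 < \tr E by exact: mxtrace_expmx_gt0.
have expE : expmx (L - eta *: S + (- ln (\tr E))%:M) = (\tr E)^-1 *: E.
  by rewrite expmxD_scalar // expRN lnK ?posrE.
exists (L - eta *: S + (- ln (\tr E))%:M); split => //.
- by rewrite linearD /= LHsym tr_scalar_mx.
- by rewrite expE mxtraceZ mulVf ?gt_eqF.
have Hc : op_bounded (- eta *: S) (`|eta| * spectral_norm S).
  move=> x; rewrite -scalemxAl frob_innerZl frob_innerZr.
  rewrite exprMn real_normK ?num_real //.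
  rewrite [leLHS]mulrA mulrNN -expr2 -[leRHS]mulrA.
  by rewrite ler_wpM2l ?sqr_ge0 ?spectral_norm_mul.
have := ln_mxtrace_expmx_le k_gt0 Lsym Hsym _ Hc.
rewrite mulr_ge0 ?spectral_norm_ge0 // => /(_ isT).
rewrite scaleNr -/E trL ln1 subr0 /gibbs_mean trL divr1 mulNmx -scalemxAl.
rewrite !exprMn real_normK ?num_real // (raddfN (@mxtrace R k)) /= mxtraceZ.
move=> lnE.
rewrite !mulmxDr mulmxN mulmxBl mul_mx_scalar -scalemxAr.
rewrite !mxtraceD !(raddfN (@mxtrace R k)) /= !mxtraceZ trTheta mulr1.
rewrite [\tr (S *m _)]mxtrace_mulC in lnE.
lra.
Qed.

End Gibbs.

(** * Regret *)

Section Regret.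
Context {R : realType}.

Lemma sum_CS (n : nat) (u v : nat -> R) :
  (\sum_(0 <= t < n) u t * v t) ^+ 2
    <= (\sum_(0 <= t < n) u t ^+ 2) * \sum_(0 <= t < n) v t ^+ 2.
Proof.
have innerE (f g : nat -> R) :
    frob_inner (\col_(t < n) f t) (\col_(t < n) g t)
    = \sum_(0 <= t < n) f t * g t.
  rewrite frob_inner_mx11 mxE big_mkord.
  by apply: eq_bigr => t _; rewrite !mxE.
rewrite -innerE; under [X in _ <= X * _]eq_bigr do rewrite expr2.
under [X in _ <= _ * X]eq_bigr do rewrite expr2.
by rewrite -!innerE frob_inner_CS.
Qed.

(** As 2 J = eta a, the sum of the J t is half that of
    (eta sqrt a) (sqrt a), and eta^2 a = 2 eta J. *)
Lemma sum_le_sqrt_of_weighted (T : nat) (J a eta : nat -> R) (C : R) :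
  (forall t, 0 <= J t) -> (forall t, 0 <= a t) ->
  (forall t, eta t * a t = 2 * J t) ->
  \sum_(0 <= t < T) eta t * J t <= C ->
  \sum_(0 <= t < T) J t <= Num.sqrt (C / 2 * \sum_(0 <= t < T) a t).
Proof.
move=> J_ge0 a_ge0 etaE le_C.
have -> : \sum_(0 <= t < T) J t
    = 2^-1 * \sum_(0 <= t < T) (eta t * Num.sqrt (a t)) * Num.sqrt (a t).
  rewrite mulr_sumr; apply: eq_bigr => t _.
  by rewrite -mulrA -expr2 sqr_sqrtr // etaE mulKf.
set M := 2^-1 * _.
apply: (le_trans (ler_norm M)); rewrite -sqrtr_sqr; apply: ler_wsqrtr.
have S_ge0 : 0 <= \sum_(0 <= t < T) a t by apply: sumr_ge0.
rewrite /M exprMn.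
have := sum_CS T (fun t => eta t * Num.sqrt (a t)) (fun t => Num.sqrt (a t)).
under [X in _ <= _ * X]eq_bigr do rewrite sqr_sqrtr //.
have -> : \sum_(0 <= t < T) (eta t * Num.sqrt (a t)) ^+ 2
    = 2 * \sum_(0 <= t < T) eta t * J t.
  rewrite mulr_sumr; apply: eq_bigr => t _.
  by rewrite exprMn sqr_sqrtr // expr2 -mulrA etaE; ring.
have := ler_wpM2r S_ge0 le_C; rewrite -mulrA.
move: (\sum_(_ <= _ < _) eta _ * J _ ) (\sum_(_ <= _ < _) a _) => V S h1 h2.
by apply: (le_trans (ler_wpM2l _ h2)); [exact: sqr_ge0|lra].
Qed.

Lemma mxtrace_mul_sym_part k (E G : 'M[R]_k) : E^T = E ->
  \tr (E *m sym_part G) = \tr (E *m G).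
Proof.
move=> Esym; rewrite /sym_part -scalemxAr mxtraceZ mulmxDr mxtraceD.
rewrite -[\tr (E *m G^T)]mxtrace_tr trmx_mul trmxK Esym.
rewrite [\tr (G *m E)]mxtrace_mulC.
by field.
Qed.

Lemma trmx_sym_part k (G : 'M[R]_k) : (sym_part G)^T = sym_part G.
Proof. by rewrite /sym_part linearZ linearD /= trmxK addrC. Qed.

Lemma loss_ge0 n1 n2 k (B : 'M[R]_(k, n2) -> 'M[R]_(n1, n2))
    (Theta Th : 'M[R]_k) psi :
  0 <= loss B Theta psi Th.
Proof. by rewrite mulr_ge0 ?invr_ge0 ?sqr_ge0. Qed.

(** The loss is a quadratic form in Theta - Th, so by Euler's identity the
    derivative at Th in the direction Th - Theta is twice its value; this
    direction being symmetric, it only sees the symmetric part of the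
    gradient. *)
Lemma loss_grad_pairing n1 n2 k
    (B : {linear 'M[R]_(k, n2) -> 'M[R]_(n1, n2)})
    (Bt : 'M[R]_(n1, n2) -> 'M[R]_(k, n2)) (Theta Th : 'M[R]_k) psi :
  is_adjoint B Bt -> Theta^T = Theta -> Th^T = Th ->
  \tr ((Th - Theta) *m sym_part (loss_grad Bt psi (B ((Theta - Th) *m psi))))
    = 2 * loss B Theta psi Th.
Proof.
move=> hBt symTheta Th_sym.
have Esym : (Th - Theta)^T = Th - Theta by rewrite linearB /= symTheta Th_sym.
set Y := B ((Theta - Th) *m psi).
rewrite mxtrace_mul_sym_part // /loss_grad mulmxN (raddfN (@mxtrace R k)) /=.
rewrite mulmxA mxtrace_mulC mulmxA -[in psi^T *m _]Esym -trmx_mul.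
rewrite -[\tr _]/(frob_inner ((Th - Theta) *m psi) (Bt Y)).
rewrite -hBt /loss sqr_frob_norm mulVKf //.
have -> : B ((Th - Theta) *m psi) = -1 *: Y.
  by rewrite scaleN1r -linearN -mulNmx opprB.
by rewrite frob_innerZl mulN1r opprK.
Qed.

End Regret.

Theorem corollary8 (R : realType) (n1 n2 k : nat)
  (hn1 : (0 < n1)%N) (hn2 : (0 < n2)%N) (hk : (0 < k)%N)
  (A : {linear 'M[R]_(n1, n2) -> 'M[R]_(n1, n2)})
  (B : {linear 'M[R]_(k, n2) -> 'M[R]_(n1, n2)})
  (K : {linear 'M[R]_(n1, n2) -> 'M[R]_(k, n2)})
  (Bt : {linear 'M[R]_(n1, n2) -> 'M[R]_(k, n2)})
  (hAK : schur_stable (fun Y => A Y - B (K Y)))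
  (hBt : is_adjoint B Bt)
  (Psi : 'M[R]_(n1, n2) -> nat -> 'M[R]_(k, n2))
  (Ud : nat -> 'M[R]_(k, n2))
  (hUd : exists M : R, forall t, frob_norm (Ud t) <= M)
  (Theta : 'M[R]_k) (hTheta : spectraplex Theta)
  (eps : nat -> R)
  (heps0 : forall t, 0 <= eps t.+1)
  (heps : exists M : R, forall t, eps t.+1 <= M)
  (X : nat -> 'M[R]_(n1, n2)) (U : nat -> 'M[R]_(k, n2))
  (That : nat -> 'M[R]_k)
  (Xres : nat -> 'M[R]_(n1, n2)) (J : nat -> R) (G : nat -> 'M[R]_k)
  (eta : nat -> R)
  (hX : forall t, X t.+1 = A (X t) + B (Theta *m Psi (X t) t + U t))
  (hU : forall t, U t = - K (X t) - That t *m Psi (X t) t + Ud t)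
  (hXres : forall t,
     Xres t.+1 = X t.+1 - (A (X t) - B (K (X t))) - B (Ud t))
  (hJ : forall t, J t = loss B Theta (Psi (X t) t) (That t))
  (hG : forall t, G t = loss_grad Bt (Psi (X t) t) (Xres t.+1))
  (heta : forall t,
     eta t.+1 =
       if eps t.+1 + spectral_norm (sym_part (G t)) ^+ 2 == 0 then 0
       else 2 * J t / (eps t.+1 + spectral_norm (sym_part (G t)) ^+ 2))
  (hThat0 : That 0%N = (k%:R)^-1 *: 1%:M)
  (hThat : forall t,
     That t.+1 =
       (\tr (expmx (lnmx (That t) - eta t.+1 *: sym_part (G t))))^-1
         *: expmx (lnmx (That t) - eta t.+1 *: sym_part (G t))) :
  forall T : nat, (1 <= T)%N ->
    \sum_(0 <= t < T) J t
      <= Num.sqrt (ln (k%:R : R) / 2 *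
           \sum_(0 <= t < T)
              (eps t.+1 + spectral_norm (sym_part (G t)) ^+ 2)).
Proof.
have symTheta : Theta^T = Theta by apply/symmetricmxP; case: hTheta => [[]].
have [psdTheta trTheta] := hTheta.
pose a t := eps t.+1 + spectral_norm (sym_part (G t)) ^+ 2.
have XresE t : Xres t.+1 = B ((Theta - That t) *m Psi (X t) t).
  rewrite hXres hX hU.
  have -> : Theta *m Psi (X t) t + (- K (X t) - That t *m Psi (X t) t + Ud t)
      = (Theta - That t) *m Psi (X t) t - K (X t) + Ud t.
    by rewrite mulmxBl; apply/matrixP => i j; rewrite !mxE; ring.
  rewrite [B (_ + Ud t)]linearD [B (_ - K _)]linearB /=.
  by apply/matrixP => i j; rewrite !mxE; ring.
have J_ge0 t : 0 <= J t by rewrite hJ loss_ge0.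
have a_ge0 t : 0 <= a t by rewrite addr_ge0 ?sqr_ge0.
have pairing t : (That t)^T = That t ->
    \tr ((That t - Theta) *m sym_part (G t)) = 2 * J t.
  by move=> That_sym; rewrite hG XresE hJ loss_grad_pairing.
(* When the denominator of the step size is 0, so is the symmetric part of the
   gradient; the pairing then gives J t = 0. *)
have etaE t : (That t)^T = That t -> eta t.+1 * a t = 2 * J t.
  move=> That_sym; rewrite heta -/(a t); case: eqP => [a0|/eqP a0]; last first.
    by rewrite divfK.
  have : spectral_norm (sym_part (G t)) ^+ 2 = 0.
    apply/eqP; rewrite eq_le sqr_ge0 andbT.
    by move: a0; rewrite /a; have := heps0 t; lra.
  move=> /eqP; rewrite sqrf_eq0 => /eqP/spectral_norm_eq0 G0.
  by rewrite -pairing // G0 mulmx0 mxtrace0 mul0r.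
have inv t : exists L, [/\ L^T = L, That t = expmx L, \tr (expmx L) = 1 &
    - \tr (Theta *m L) + \sum_(0 <= s < t) eta s.+1 * J s <= ln k%:R].
  elim: t => [|t [L [Lsym ThatE trL pot]]].
    (* The matrix I / k has logarithm - ln k times the identity. *)
    exists ((- ln k%:R)%:M); rewrite tr_scalar_mx big_nil addr0.
    have kR_gt0 : 0 < k%:R :> R by rewrite ltr0n.
    have expL : expmx ((- ln k%:R)%:M : 'M[R]_k) = (k%:R)^-1 *: 1%:M.
      by rewrite expmx_scalar expRN lnK ?posrE.
    split=> //; first by rewrite hThat0 expL.
      by rewrite expL mxtraceZ mxtrace1 mulVf ?gt_eqF.
    by rewrite mul_mx_scalar mxtraceZ trTheta mulr1 opprK.
  have That_sym : (That t)^T = That t by rewrite ThatE trmx_expmx.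
  have [L' [L'sym L'E trL' pot']] := exp_gradient_step
    (eta t.+1) hk Lsym (trmx_sym_part (G t)) trL trTheta.
  exists L'; split=> //; first by rewrite hThat ThatE lnmx_expmx // L'E.
  rewrite big_nat_recr //=.
  have := pairing t That_sym; have := etaE t That_sym.
  have : (eta t.+1 * spectral_norm (sym_part (G t))) ^+ 2
      <= eta t.+1 * (eta t.+1 * a t).
    by rewrite mulrA -expr2 exprMn ler_wpM2l ?sqr_ge0 // lerDr.
  move: pot' pot; rewrite -ThatE => pot' pot w_le etaJ trE.
  rewrite etaJ in w_le; rewrite trE in pot'; move: pot' pot w_le.
  move: (\tr (Theta *m L')) (\tr (Theta *m L)) (_ ^+ 2) (\sum_(_ <= _ < _) _).
  by move=> u v w s; lra.
move=> T _.
apply: (sum_le_sqrt_of_weighted (eta := fun t => eta t.+1)) => // [t|].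
  by have [L [Lsym ThatE _ _]] := inv t; apply: etaE; rewrite ThatE trmx_expmx.
have [L [Lsym _ trL pot]] := inv T; apply: le_trans pot.
rewrite lerDr oppr_ge0; apply: mxtrace_mul_psd_le0 => // x.
exact: log_density_le0.
Qed.
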